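(* Let $S=\{x_1,\dots,x_n\}$ be a finite set of points in general position in $\mathbb{R}^d$. For a triangulation $t$ of $S$ with $d$-simplices $\Delta_i$, where $\Delta_i$ has vertices $x_{i0},x_{i1},\dots,x_{id}\in S$, put $$Vr(t)=\sum_i\left(\|x_{i0}\|^2+\|x_{i1}\|^2+\dots+\|x_{id}\|^2\right)\operatorname{vol}(\Delta_i).$$ Then the functional $Vr$, on the set of all triangulations of $S$, achieves its minimum at $t$ if and only if $t$ is the Delaunay triangulation of $S$.
   Context: A set $S\subset\mathbb{R}^d$ with $|S|=n\ge d+1$ is in general position if no $d+1$ of its points lie on a common hyperplane and no $d+2$ of its points lie on a common sphere. A triangulation of $S$ is a triangulation of the polytope $CH(S)$ (the convex hull of $S$) whose vertices belong to $S$. The Delaunay triangulation $DT(S)$ is the straight-line dual of the Voronoi diagram of $S$; equivalently, its $d$-simplices are exactly the $d$-simplices with vertices in $S$ whose circumscribed sphere has no point of $S$ in its interior. For $S$ in general position it is a uniquely determined triangulation of $S$, with vertex set $S$. $\operatorname{vol}$ is $d$-dimensional volume and $\|\cdot\|$ is the Euclidean norm. The functional $Vr$ is called the parabolic (or Voronoi) functional. *)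

(* Defs.v *)
From HB Require Import structures.
From mathcomp Require Import all_boot all_order all_algebra.
From mathcomp Require Import all_classical all_reals all_analysis.

Set Implicit Arguments.
Unset Strict Implicit.
Unset Printing Implicit Defensive.
Import Order.TTheory GRing.Theory Num.Theory.

Local Open Scope classical_set_scope.
Local Open Scope ring_scope.

(* MathComp-Analysis provides Lebesgue measure on R only.  For d-dimensional
   volume, R^d is seen as R * (R * (... * unit)) with its product
   sigma-algebra, carrying the d-fold product of the Lebesgue measure of R. *)
Fixpoint prodR_display (R : realType) (d : nat) : measure_display :=
  if d is d'.+1 then
    measure_prod_display
      (sigma_display (@measurable _ (ocitv_type R)), prodR_display R d')
  else default_measure_display.

Fixpoint prodR (R : realType) (d : nat) : measurableType (prodR_display R d) :=
  match d return measurableType (prodR_display R d) with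
  | 0 => unit
  | d'.+1 => (measurableTypeR R * prodR R d')%type
  end.

Fixpoint prodR_lebesgue (R : realType) (d : nat) :
    set (prodR R d) -> \bar R :=
  match d return set (prodR R d) -> \bar R with
  | 0 => \d_tt
  | d'.+1 => (@lebesgue_measure R \x @prodR_lebesgue R d')%E
  end.

Fixpoint prodR_of_rV (R : realType) (d : nat) : 'rV[R]_d -> prodR R d :=
  match d return 'rV[R]_d -> prodR R d with
  | 0 => fun=> tt
  | d'.+1 => fun v => (v ord0 ord0, prodR_of_rV (col' ord0 v))
  end.

(* [fine] maps infinite volume to 0; only bounded sets are measured below. *)
Definition vol (R : realType) (d : nat) (A : set 'rV[R]_d) : R :=
  fine (prodR_lebesgue (@prodR_of_rV R d @` A)).

(* The library norm `|v| on 'rV[R]_d is the sup norm. *)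
Definition enorm (R : realType) (d : nat) (v : 'rV[R]_d) : R :=
  Num.sqrt (\sum_(j < d) v ord0 j ^+ 2).

Definition sphere (R : realType) (d : nat) (c : 'rV[R]_d) (r : R) :
    set 'rV[R]_d :=
  [set p | enorm (p - c) = r].

Definition hyperplane (R : realType) (d : nat) (a : 'rV[R]_d) (b : R) :
    set 'rV[R]_d :=
  [set p | \sum_(j < d) a ord0 j * p ord0 j = b].

(* A finite point set S = {x_0, ..., x_(n-1)} is given by an injective family
   x : 'I_n -> 'rV[R]_d, and subsets of S by sets of indices. *)
Section PointConfiguration.
Variables (R : realType) (d n : nat) (x : 'I_n -> 'rV[R]_d).
Implicit Types (A B : {set 'I_n}) (t : {set {set 'I_n}}).

Definition general_position : Prop :=
  (forall A, #|A| = d.+1 ->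
     ~ exists (a : 'rV[R]_d) (b : R),
         a <> 0 /\ forall i, i \in A -> hyperplane a b (x i)) /\
  (forall A, #|A| = d.+2 ->
     ~ exists (c : 'rV[R]_d) (r : R), forall i, i \in A -> sphere c r (x i)).

Definition conv A : set 'rV[R]_d :=
  [set p | exists w : 'I_n -> R,
     [/\ forall i, 0 <= w i,
         \sum_(i in A) w i = 1 &
         p = \sum_(i in A) w i *: x i]].

Definition affinely_independent A : Prop :=
  forall w : 'I_n -> R,
    \sum_(i in A) w i = 0 -> \sum_(i in A) w i *: x i = 0 ->
    forall i, i \in A -> w i = 0.

(* Vertex set of a d-simplex. *)
Definition simplex A : Prop := #|A| = d.+1 /\ affinely_independent A.

(* A triangulation is represented by the vertex sets of its d-simplices, which
   determine the remaining faces.  The points of S need not all be vertices. *)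
Definition triangulation t : Prop :=
  [/\ forall A, A \in t -> simplex A,
      forall p, conv [set: 'I_n]%SET p <-> exists2 A, A \in t & conv A p &
      forall A B, A \in t -> B \in t ->
        conv A `&` conv B = conv (A :&: B)%SET].

Definition empty_circumsphere A : Prop :=
  exists (c : 'rV[R]_d) (r : R),
    (forall i, i \in A -> sphere c r (x i)) /\
    (forall j, ~ enorm (x j - c) < r).

Definition delaunay : {set {set 'I_n}} :=
  [set A | `[< simplex A /\ empty_circumsphere A >]]%SET.

(* Duality with the Voronoi diagram: the Delaunay simplices are the d-simplices
   whose vertices have Voronoi cells with a common point (a Voronoi vertex). *)
Definition voronoi_cell (i : 'I_n) : set 'rV[R]_d :=
  [set p | forall j, enorm (x i - p) <= enorm (x j - p)].

Lemma empty_circumsphere_voronoi A :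
  (0 < #|A|)%N ->
  empty_circumsphere A <-> exists p, forall i, i \in A -> voronoi_cell i p.
Proof.
move=> /card_gt0P[i0 i0A]; split=> [[c [r [cA cE]]]|[p pA]].
  exists c => i iA j; rewrite (cA i iA) leNgt; apply/negP; exact: cE.
exists p, (enorm (x i0 - p)); split=> [i iA|j].
  by apply/eqP; rewrite eq_le (pA i iA) (pA i0 i0A).
by apply/negP; rewrite -leNgt; exact: pA.
Qed.

Definition Vr t : R :=
  \sum_(A in t) (\sum_(i in A) enorm (x i) ^+ 2) * vol (conv A).

End PointConfiguration.

(* Main.v *)
From Pilot Require Import Defs.
From HB Require Import structures.
From mathcomp Require Import all_boot all_order all_algebra.
From mathcomp Require Import all_classical all_reals all_analysis.
From mathcomp Require Import measurable_realfun.
From mathcomp Require Import ring lra.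
Import Pilot.Defs.

(** Lift every point p to height |p|^2.  An affine function agrees with the
    height on a sphere and lies below the height exactly outside that sphere
    ([aff_sphere_aff]); hence a Delaunay simplex is a set of d + 1 points on
    which some affine function meets the heights while staying below them at
    all points of S, that is, a lower facet of the lifted convex hull
    ([delaunayP]).  General position makes these contacts nondegenerate: at
    most d + 1 points are met at a time ([card_cospherical]).

    The Delaunay simplices triangulate ([delaunay_triangulation]).  Given p in
    the convex hull, choose the facet whose affine function is largest at p;
    if p were outside of its simplex, one step of the simplex algorithm would
    lead to a facet with a larger value at p ([delaunay_cover]).  Two facets
    have the same height at a common point of their simplices, so this point
    uses only common vertices.

    For the functional, the barycentric coordinates of a simplex all have the
    same integral over it, since a superlevel set of one is a translate of a
    superlevel set of another ([cell_superlevel]); they add up to 1, so each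
    integral is the volume divided by d + 1 ([integral_barycentric]).
    Consequently the contribution of a simplex to Vr is d + 1 times the
    integral over it of the affine interpolation of the heights.  This
    interpolation lies above the lower hull, with equality almost everywhere
    exactly for Delaunay simplices ([simplex_excess_ge0]).  The integral of the
    lower hull over the simplices of a triangulation adds up to its integral
    over the convex hull of S ([integral_lower_hull]), whatever the
    triangulation.  So Vr t is a constant plus the sum of the nonnegative
    excesses of the simplices of t, and it is minimal if and only if they are
    all Delaunay simplices ([Vr_min]); a triangulation made of Delaunay
    simplices has to use all of them ([triangulation_subset]). *)

Set Implicit Arguments.
Unset Strict Implicit.
Unset Printing Implicit Defensive.
Import Order.TTheory GRing.Theory Num.Theory.

Local Open Scope classical_set_scope.
Local Open Scope ring_scope.

(** * Lebesgue measure on iterated products *)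

Section product_sigma_finite.
Context d1 d2 (T1 : measurableType d1) (T2 : measurableType d2) (R : realType).
Variables (m1 : {sigma_finite_measure set T1 -> \bar R})
  (m2 : {sigma_finite_measure set T2 -> \bar R}).

(** The alias carries the sigma-finite structure, which the induction over the
    dimension below requires of both factors. *)
Definition product_measure : set (T1 * T2) -> \bar R := (m1 \x m2)%E.

HB.instance Definition _ := Measure.on product_measure.

Let product_measure_sigma_finite : sigma_finite setT product_measure.
Proof.
have [/sigma_finiteP[F [TF Fi Ffin]] /sigma_finiteP[G [TG Gi Gfin]]] :=
  (sigma_finiteT m1, sigma_finiteT m2).
exists (fun k => F k `*` G k) => [|k].
  apply/seteqP; split=> // -[a b] _.
  have [/= i _ Fia] : (\bigcup_k F k) a by rewrite -TF.
  have [/= j _ Gjb] : (\bigcup_k G k) b by rewrite -TG.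
  exists (maxn i j) => //=; split.
    by have /subsetPset := Fi _ _ (leq_maxl i j); exact.
  by have /subsetPset := Gi _ _ (leq_maxr i j); exact.
have [[mF Foo] [mG Goo]] := (Ffin k, Gfin k).
split; first exact: measurableX.
by rewrite /product_measure product_measure1E// lte_mul_pinfty ?ge0_fin_numE.
Qed.

HB.instance Definition _ :=
  Measure_isSigmaFinite.Build _ _ _ product_measure product_measure_sigma_finite.

End product_sigma_finite.

Fixpoint lebesgue_prodR (R : realType) (d : nat) :
    {sigma_finite_measure set (prodR R d) -> \bar R} :=
  match d return {sigma_finite_measure set (prodR R d) -> \bar R} with
  | 0 => \d_tt
  | d'.+1 => product_measure (@lebesgue_measure R) (lebesgue_prodR R d')
  end.

Lemma prodR_lebesgueE (R : realType) d :
  @prodR_lebesgue R d = lebesgue_prodR R d.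
Proof. by elim: d => //= d ->. Qed.

(** The inverse of the coordinate map. Sets and functions on R^d are pulled
    back along it to the measurable space on which Lebesgue measure lives. *)
Fixpoint rV_of_prodR (R : realType) (d : nat) : prodR R d -> 'rV[R]_d :=
  match d return prodR R d -> 'rV[R]_d with
  | 0 => fun=> 0
  | d'.+1 => fun q => \row_j
      if unlift ord0 j is Some k then rV_of_prodR q.2 ord0 k else q.1
  end.
Arguments rV_of_prodR {R d}.

Lemma rV_of_prodR_head (R : realType) d (q : prodR R d.+1) :
  rV_of_prodR q ord0 ord0 = q.1.
Proof. by rewrite mxE unlift_none. Qed.

Lemma rV_of_prodR_tail (R : realType) d (q : prodR R d.+1) (j : 'I_d) :
  rV_of_prodR q ord0 (lift ord0 j) = rV_of_prodR q.2 ord0 j.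
Proof. by rewrite mxE liftK. Qed.

Lemma col'_rV_of_prodR (R : realType) d (q : prodR R d.+1) :
  col' ord0 (rV_of_prodR q) = rV_of_prodR q.2.
Proof. by apply/rowP => j; rewrite mxE rV_of_prodR_tail. Qed.

Lemma prodR_of_rVK (R : realType) d :
  cancel (@prodR_of_rV R d) rV_of_prodR.
Proof.
elim: d => [|d IHd] v; first by apply/rowP; case.
apply/rowP => j; case: (unliftP ord0 j) => [k ->|->].
  by rewrite rV_of_prodR_tail /= IHd mxE.
by rewrite rV_of_prodR_head.
Qed.

Lemma rV_of_prodRK (R : realType) d :
  cancel rV_of_prodR (@prodR_of_rV R d).
Proof.
elim: d => [[]//|d IHd] q.
by rewrite [LHS]/= rV_of_prodR_head col'_rV_of_prodR IHd; case: q.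
Qed.

Lemma image_prodR_of_rV (R : realType) d (A : set 'rV[R]_d) :
  @prodR_of_rV R d @` A = rV_of_prodR @^-1` A.
Proof.
apply/seteqP; split => [_ [v Av <-]|q Aq] /=; first by rewrite prodR_of_rVK.
by exists (rV_of_prodR q) => //; rewrite rV_of_prodRK.
Qed.

Lemma measurable_coord (R : realType) d (j : 'I_d) :
  measurable_fun [set: prodR R d] (fun q => rV_of_prodR q ord0 j).
Proof.
elim: d j => [[]//|d IHd] j.
case: (unliftP ord0 j) => [k ->|->].
  rewrite [X in measurable_fun _ X](funext (fun q => rV_of_prodR_tail q k)).
  exact: (measurableT_comp (IHd k) measurable_snd).
rewrite [X in measurable_fun _ X](funext (fun q => rV_of_prodR_head q)).
exact: measurable_fst.
Qed.

(** * Affine functions *)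

(** Homogeneous coordinates, with the extra coordinate 1 in front, turn affine
    functions into column vectors and affine dependence into linear
    dependence. *)
Definition homog (R : realType) d (p : 'rV[R]_d) : 'rV[R]_d.+1 :=
  \row_j if unlift ord0 j is Some k then p ord0 k else 1.

Definition aff (R : realType) d (c : 'cV[R]_d.+1) (p : 'rV[R]_d) : R :=
  (homog p *m c) 0 0.

Lemma affE (R : realType) d (c : 'cV[R]_d.+1) (p : 'rV[R]_d) :
  aff c p = c ord0 0 + \sum_j p ord0 j * c (lift ord0 j) 0.
Proof.
rewrite /aff mxE big_ord_recl mxE unlift_none mul1r; congr (_ + _).
by apply: eq_bigr => j _; rewrite mxE liftK.
Qed.

Section affine.
Context (R : realType) (d : nat).
Implicit Types (c : 'cV[R]_d.+1) (p : 'rV[R]_d).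

Lemma affD c1 c2 p : aff (c1 + c2) p = aff c1 p + aff c2 p.
Proof. by rewrite /aff mulmxDr mxE. Qed.

Lemma affZ a c p : aff (a *: c) p = a * aff c p.
Proof. by rewrite /aff -scalemxAr mxE. Qed.

Lemma affN c p : aff (- c) p = - aff c p.
Proof. by rewrite /aff mulmxN mxE. Qed.

(** Affine functions commute with affine combinations: the weights of sum 1
    absorb the constant term. *)
Lemma aff_sum c n (x : 'I_n -> 'rV[R]_d) (A : {set 'I_n}) (w : 'I_n -> R) :
  \sum_(i in A) w i = 1 ->
  aff c (\sum_(i in A) w i *: x i) = \sum_(i in A) w i * aff c (x i).
Proof.
move=> w1; rewrite affE; under [RHS]eq_bigr do rewrite affE mulrDr.
rewrite big_split /= -mulr_suml w1 mul1r; congr (_ + _).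
under [RHS]eq_bigr do rewrite mulr_sumr.
rewrite exchange_big/=; apply: eq_bigr => j _.
rewrite summxE mulr_suml; apply: eq_bigr => i _.
by rewrite mxE mulrA.
Qed.

Lemma aff_translate c p s (u v : 'rV[R]_d) :
  aff c (p + s *: (u - v)) = aff c p + s * (aff c u - aff c v).
Proof.
rewrite !affE opprD addrACA subrr add0r -addrA; congr (_ + _).
rewrite -sumrB mulr_sumr -big_split/=; apply: eq_bigr => j _.
by rewrite !mxE; ring.
Qed.

End affine.

Lemma measurable_aff (R : realType) d (c : 'cV[R]_d.+1) D :
  measurable_fun D (fun q : prodR R d => aff c (rV_of_prodR q)).
Proof.
apply: measurable_funTS.
under eq_fun do rewrite affE.
apply: measurable_funD => //; apply: measurable_sum => j.
by apply: measurable_funM => //; exact: measurable_coord.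
Qed.

Lemma measurable_aff_ge (R : realType) d (s : R) (c : 'cV[R]_d.+1) :
  measurable [set q : prodR R d | s <= aff c (rV_of_prodR q)].
Proof.
rewrite -[X in measurable X]setTI.
apply: (measurable_fun_ler (D := setT) (f := cst s)
  (g := fun q => aff c (rV_of_prodR q)) _ _ measurableT (Y := [set true])) => //.
exact: measurable_aff.
Qed.

Lemma measurable_hyperplane (R : realType) d (c : 'cV[R]_d.+1) :
  measurable [set q : prodR R d | aff c (rV_of_prodR q) = 0].
Proof.
rewrite -[X in measurable X]setTI.
exact: (measurable_aff c measurableT (measurable_set1 0)).
Qed.

(** * Translations, hyperplanes and boxes *)

Lemma measurable_fun_shift (R : realType) (a : R) :
  measurable_fun setT (fun r : measurableTypeR R => r + a : measurableTypeR R).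
Proof. exact: measurable_funD. Qed.

(** Both sides are measures that agree on half-open intervals. *)
Lemma lebesgue_measure_shift (R : realType) (a : R) (A : set R) :
  measurable A ->
  lebesgue_measure ((fun r : measurableTypeR R => r + a) @^-1` A) =
  lebesgue_measure A.
Proof.
pose m : {measure set (measurableTypeR R) -> \bar R} :=
  pushforward lebesgue_measure (fun r : measurableTypeR R => r + a : measurableTypeR R).
move=> mA; apply/esym; rewrite -[RHS]/(m (measurable_fun_shift a) A).
apply: lebesgue_measure_unique => // _ [[b c]] _ <-.
rewrite /m /= /pushforward.
rewrite (_ : _ @^-1` _ = `]b - a, c - a]%classic); last first.
  by apply/seteqP; split => r /=; rewrite !in_itv/= lerBrDr ltrBlDr.
by rewrite !lebesgue_measure_itv/= !lte_fin ltrD2r -!EFinB opprB addrA addrNK.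
Qed.

Lemma prodR_shiftS (R : realType) d (v : 'rV[R]_d.+1) (q : prodR R d.+1) :
  prodR_of_rV (rV_of_prodR q + v) =
  (q.1 + v ord0 ord0, prodR_of_rV (rV_of_prodR q.2 + col' ord0 v)).
Proof.
by rewrite [LHS]/= mxE rV_of_prodR_head raddfD /= col'_rV_of_prodR.
Qed.

Lemma measurable_shift (R : realType) d (v : 'rV[R]_d) :
  measurable_fun setT (fun q : prodR R d => prodR_of_rV (rV_of_prodR q + v)).
Proof.
elim: d v => [|d IHd] v //.
rewrite (funext (prodR_shiftS v)); apply: measurable_fun_pair.
  by apply: measurable_funD => //; exact: measurable_fst.
exact: (measurableT_comp (IHd _) measurable_snd).
Qed.

(** The coefficients of the restriction of an affine function to the slice of
    first coordinate s. *)
Definition aff_section (R : realType) d (c : 'cV[R]_d.+2) (s : R) : 'cV[R]_d.+1 :=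
  \col_i if unlift ord0 i is Some k then c (lift ord0 (lift ord0 k)) 0
          else c ord0 0 + s * c (lift ord0 ord0) 0.

Lemma aff_sectionE (R : realType) d (c : 'cV[R]_d.+2) (q : prodR R d.+1) :
  aff c (rV_of_prodR q) = aff (aff_section c q.1) (rV_of_prodR q.2).
Proof.
rewrite !affE big_ord_recl rV_of_prodR_head mxE unlift_none addrA.
congr (_ + _); apply: eq_bigr => j _.
by rewrite rV_of_prodR_tail mxE liftK.
Qed.

(** A nonzero affine function vanishes identically on at most one slice: its
    other linear coefficients must be zero, so that it only depends on the
    first coordinate and has a single root. When the first linear coefficient
    is zero as well, the hypotheses are contradictory. *)
Lemma aff_section_eq0 (R : realType) d (c : 'cV[R]_d.+2) (s : R) :
  c != 0 -> aff_section c s = 0 -> s = - c ord0 0 / c (lift ord0 ord0) 0.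
Proof.
move=> c0 /colP cs0.
have /esym/eqP := cs0 ord0; rewrite !mxE unlift_none addrC -subr_eq sub0r eq_sym.
move=> /eqP sE; have ck k : c (lift ord0 (lift ord0 k)) 0 = 0.
  by have := cs0 (lift ord0 k); rewrite !mxE liftK.
have [c10|c10] := eqVneq (c (lift ord0 ord0) 0) 0; last by rewrite -sE mulfK.
move/eqP: c0; case; apply/colP => i; rewrite mxE.
case: (unliftP ord0 i) => [j|] ->; last first.
  by move: sE; rewrite c10 mulr0 => /eqP; rewrite eq_sym oppr_eq0 => /eqP.
by case: (unliftP ord0 j) => [k|] ->.
Qed.

(** By induction on the dimension: all slices of the hyperplane but at most
    one are zero sets of nonzero affine functions, and one slice does not
    count for the outer integral. *)
Lemma lebesgue_prodR_hyperplane (R : realType) d (c : 'cV[R]_d.+1) :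
  c != 0 -> lebesgue_prodR R d [set q | aff c (rV_of_prodR q) = 0] = 0%E.
Proof.
elim: d c => [|d IHd] c c0.
  rewrite (_ : [set _ | _] = set0) ?measure0//.
  apply/seteqP; split => // q /=; rewrite affE big_ord0 addr0 => cE.
  by move/eqP: c0; apply; apply/colP => j; rewrite mxE !ord1.
have mf := measurable_fun_xsection (lebesgue_prodR R d) (measurable_hyperplane c).
set H := [set q | _] in mf *.
rewrite -[LHS]/(\int[lebesgue_measure]_s (lebesgue_prodR R d \o xsection H) s)%E.
have := @ge0_negligible_integral _ (measurableTypeR R) R (@lebesgue_measure R) setT
  [set (- c ord0 0 / c (lift ord0 ord0) 0)] _ _ measurableT mf.
move=> ->//; last first.
  exact: lebesgue_measure_set1.
apply: integral0_eq => s [_ sr] /=.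
rewrite (_ : xsection _ _ = [set q | aff (aff_section c s) (rV_of_prodR q) = 0]).
  by apply: IHd; apply/eqP => /(aff_section_eq0 c0).
apply/seteqP; split => q; rewrite /xsection /= inE => Hq.
  exact: etrans (esym (aff_sectionE c ((s, q) : prodR R d.+1))) Hq.
exact: etrans (aff_sectionE c ((s, q) : prodR R d.+1)) Hq.
Qed.

(** By induction on the dimension, from uniqueness of product measures: a
    translation maps rectangles to rectangles, factor by factor. *)
Lemma lebesgue_prodR_shift (R : realType) d (v : 'rV[R]_d) (A : set (prodR R d)) :
  measurable A ->
  lebesgue_prodR R d ((fun q => prodR_of_rV (rV_of_prodR q + v)) @^-1` A) =
  lebesgue_prodR R d A.
Proof.
elim: d v A => [|d IHd] v A mA.
  by congr (lebesgue_prodR _ _ _); apply/seteqP; split => -[].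
pose m : {measure set (prodR R d.+1) -> \bar R} :=
  pushforward (lebesgue_prodR R d.+1)
    (fun q : prodR R d.+1 => prodR_of_rV (rV_of_prodR q + v)).
rewrite -[LHS]/(m (measurable_shift v) A); apply/esym.
apply: product_measure_unique => //= B C mB mC.
rewrite /m /= /pushforward.
rewrite (_ : _ @^-1` _ = ((fun r : measurableTypeR R => r + v ord0 ord0) @^-1` B) `*`
   ((fun q => prodR_of_rV (rV_of_prodR q + col' ord0 v)) @^-1` C)); last first.
  by apply/seteqP; split => q /=; rewrite mxE rV_of_prodR_head raddfD /= col'_rV_of_prodR.
rewrite /product_measure product_measure1E.
- by congr (_ * _)%E; [exact: lebesgue_measure_shift|exact: IHd].
- rewrite -[X in measurable X]setTI.
  exact: (measurable_fun_shift _ measurableT mB).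
- rewrite -[X in measurable X]setTI.
  exact: (measurable_shift _ measurableT mC).
Qed.

Lemma measurable_box (R : realType) d (r : R) :
  measurable [set q : prodR R d | forall j, - r <= rV_of_prodR q ord0 j <= r].
Proof.
rewrite (_ : [set _ | _] =
    \bigcap_(j : 'I_d) ((fun q => rV_of_prodR q ord0 j) @^-1` `[- r, r])).
  apply: fin_bigcap_measurable => // j _.
  rewrite -[X in measurable X]setTI.
  by apply: (measurable_coord j) => //; exact: measurable_itv.
by apply/seteqP; split => q /= qr j; have := qr j; rewrite /= in_itv//=; exact.
Qed.

Lemma lebesgue_prodR_box (R : realType) d (r : R) : 0 <= r ->
  lebesgue_prodR R d
    [set q | forall j, - r <= rV_of_prodR q ord0 j <= r] = ((r *+ 2) ^+ d)%:E.
Proof.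
move=> r0; elim: d => [|d IHd].
  by rewrite expr0 /= diracE mem_set// => -[].
rewrite (_ : [set _ | _] = `[- r, r]%classic `*`
  [set q : prodR R d | forall j, - r <= rV_of_prodR q ord0 j <= r]); last first.
  apply/seteqP; split => q /= qr.
    rewrite in_itv/=; split; first by have := qr ord0; rewrite rV_of_prodR_head.
    by move=> j; have := qr (lift ord0 j); rewrite rV_of_prodR_tail.
  move=> j; case: (unliftP ord0 j) => [k|] ->.
    by rewrite rV_of_prodR_tail; exact: qr.2.
  by rewrite rV_of_prodR_head; have := qr.1; rewrite /= in_itv.
rewrite /= /product_measure product_measure1E//.
  transitivity ((r *+ 2)%:E * ((r *+ 2) ^+ d)%:E)%E.
    congr (_ * _)%E; last exact: IHd.
    apply: etrans (lebesgue_measure_itv `[- r, r]) _; rewrite /= lte_fin.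
    case: ltP => [rr|rr]; first by rewrite -EFinB opprK.
    have -> : r = 0 by lra.
    by rewrite mul0rn.
  by rewrite -EFinM -exprS.
exact: measurable_box.
Qed.

(** * Integrals of nonnegative functions *)

Section measure_integral.
Context dT (T : measurableType dT) (R : realType).

(** Layer cake formula: both sides are the measure of the region below the
    graph of f, computed by Tonelli along the two factors. *)
Lemma ge0_integral_superlevel (m : {sigma_finite_measure set T -> \bar R})
    (D : set T) (f : T -> R) :
  measurable D -> measurable_fun setT f -> (forall x, D x -> 0 <= f x) ->
  (\int[m]_(x in D) (f x)%:E =
   \int[@lebesgue_measure R]_(s in `[0%R, +oo[) m (D `&` [set x | s <= f x]%R))%E.
Proof.
move=> mD mf f0.
(* the region below the graph *)
pose G : set (measurableTypeR R * T) :=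
  (`[0, +oo[%classic `*` D) `&` [set p | p.1 <= f p.2].
have mG : measurable G.
  apply: measurableI; first by apply: measurableX => //; exact: measurable_itv.
  rewrite -[X in measurable X]setTI.
  apply: (measurable_fun_ler (D := setT) (f := fst) (g := f \o snd) _ _
    measurableT (Y := [set true])) => //.
  exact: (measurableT_comp mf measurable_snd).
have := indic_fubini_tonelli (@lebesgue_measure R) m mG.
have FE := indic_fubini_tonelli_FE m mG.
have GE := indic_fubini_tonelli_GE (@lebesgue_measure R) mG.
rewrite [X in X = _ -> _](_ : _ =
  \int[lebesgue_measure]_x (m \o xsection G) x)%E; last by rewrite -FE.
rewrite [X in _ = X -> _](_ : _ =
  \int[m]_x (lebesgue_measure \o ysection G) x)%E; last by rewrite -GE.
move=> FG.
rewrite [LHS]integral_mkcond [RHS]integral_mkcond.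
transitivity (\int[m]_y (lebesgue_measure \o ysection G) y)%E; last first.
  rewrite -FG; apply: eq_integral => s _; rewrite patchE/=.
  case: ifPn => s0.
    congr (m _); apply/seteqP; split => x; rewrite /xsection /= inE /G/=.
      by case=> -[].
    by case=> Dx sf; split => //; split => //; rewrite inE in s0.
  rewrite (_ : xsection _ _ = set0) ?measure0//.
  apply/seteqP; split => x //; rewrite /xsection /= inE /G/= => -[[s0' _] _].
  by move/negP: s0; apply; rewrite inE.
apply: eq_integral => x _; rewrite patchE/=; case: ifPn => Dx.
  rewrite inE in Dx.
  rewrite (_ : ysection _ _ = `[0, f x]%classic).
    apply/esym; apply: etrans (lebesgue_measure_itv `[0, f x]) _ => /=.
    rewrite lte_fin; case: ltP => [_|fx]; first by rewrite oppr0 addr0.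
    by have -> : f x = 0 by apply/le_anti; rewrite fx f0.
  apply/seteqP; split => s; rewrite /ysection /= inE /G /= !in_itv/=.
    by rewrite andbT => -[[-> _] ->].
  by rewrite andbT => /andP[-> ->].
rewrite (_ : ysection _ _ = set0) ?measure0//.
apply/seteqP; split => s //; rewrite /ysection /= inE /G/= => -[[_ D'] _].
by move/negP: Dx; apply; rewrite inE.
Qed.

Lemma ge0_integral_sum_cond (m : {measure set T -> \bar R}) (D : set T)
    (I : finType) (P : pred I) (f : I -> T -> \bar R) :
  measurable D -> (forall i, P i -> measurable_fun D (f i)) ->
  (forall i x, P i -> D x -> (0 <= f i x)%E) ->
  (\int[m]_(x in D) (\sum_(i | P i) f i x) =
   \sum_(i | P i) \int[m]_(x in D) f i x)%E.
Proof.
move=> mD mf f0; under eq_integral do rewrite big_mkcond/=.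
rewrite (ge0_integral_sum m mD (f := fun i x => if P i then f i x else 0%E)).
- rewrite [RHS]big_mkcond/=; apply: eq_bigr => i _.
  by case: ifP => // _; rewrite integral0.
- by move=> i; case Pi: (P i); [exact: mf|exact: measurable_cst].
- by move=> i y Dy; case: ifPn => Pi //; exact: f0.
Qed.

(** The nonnegative function f - g has integral zero, because the integral of
    g is finite and can be cancelled. *)
Lemma ge0_integral_eq_ae (m : {measure set T -> \bar R}) (D : set T)
    (f g : T -> R) :
  measurable D -> measurable_fun setT f -> measurable_fun setT g ->
  (forall x, D x -> 0 <= g x <= f x) ->
  (\int[m]_(x in D) (f x)%:E < +oo)%E ->
  (\int[m]_(x in D) (f x)%:E <= \int[m]_(x in D) (g x)%:E)%E ->
  \forall x \ae m, D x -> f x = g x.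
Proof.
move=> mD mf mg gf foo fg.
have mfD : measurable_fun D (EFin \o f) by apply/measurable_EFinP/measurable_funTS.
have mgD : measurable_fun D (EFin \o g) by apply/measurable_EFinP/measurable_funTS.
have mh : measurable_fun D (fun x => (f x - g x)%:E).
  by apply/measurable_EFinP/measurable_funTS; exact: measurable_funB.
have g0 x : D x -> (0 <= (g x)%:E)%E by move=> /gf/andP[]; rewrite lee_fin.
have h0 x : D x -> (0 <= (f x - g x)%:E)%E.
  by move=> /gf/andP[_]; rewrite lee_fin subr_ge0.
have fE : (\int[m]_(x in D) (f x)%:E =
    \int[m]_(x in D) (g x)%:E + \int[m]_(x in D) (f x - g x)%:E)%E.
  rewrite -ge0_integralD//; apply: eq_integral => x _.
  by rewrite -EFinD subrKC.
have gfin : (\int[m]_(x in D) (g x)%:E)%E \is a fin_num.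
  rewrite ge0_fin_numE ?integral_ge0//; apply: le_lt_trans foo.
  by rewrite fE leeDl// integral_ge0.
have h_eq0 : (\int[m]_(x in D) (f x - g x)%:E = 0)%E.
  apply/eqP; rewrite eq_le integral_ge0// andbT.
  by move: fg; rewrite fE -[leRHS]adde0 leeD2lE.
have /(ae_eq_integral_abs m mD mh) : (\int[m]_(x in D) `|(f x - g x)%:E| = 0)%E.
  rewrite -[RHS]h_eq0; apply: eq_integral => x; rewrite inE => Dx.
  by rewrite gee0_abs// h0.
apply: filterS => x /= hx Dx; have := hx Dx => -[] /eqP.
by rewrite subr_eq0 => /eqP.
Qed.

(** Replace B by B minus the overlap, which changes no integral and makes the
    union disjoint. *)
Lemma ge0_integral_setU_null (m : {measure set T -> \bar R}) (A B : set T)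
    (f : T -> \bar R) :
  measurable A -> measurable B -> m (A `&` B) = 0%E ->
  measurable_fun (A `|` B) f -> (forall x, (A `|` B) x -> (0 <= f x)%E) ->
  (\int[m]_(x in A `|` B) f x = \int[m]_(x in A) f x + \int[m]_(x in B) f x)%E.
Proof.
move=> mA mB AB0 mf f0; have mAB := measurableI _ _ mA mB.
have UE : A `|` B = A `|` (B `\` (A `&` B)).
  apply/seteqP; split => x /= [Ax|Bx]; [by left| |by left|by right; case: Bx].
  by have [Ax|nAx] := pselect (A x); [left|right; split=> // -[]].
have mfB : measurable_fun B f.
  by apply: measurable_funS mf; [exact: measurableU|exact: subsetUr].
rewrite (ge0_negligible_integral mAB mB mfB)// => [|x Bx]; last first.
  by apply: f0; right.
rewrite UE; apply: ge0_integral_setU => //; rewrite -?UE//.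
  exact: measurableD.
by apply/disj_setPS => x [Ax [Bx]]; apply.
Qed.

Lemma ge0_integral_bigsetU_null (m : {measure set T -> \bar R}) (I : choiceType)
    (s : seq I) (F : I -> set T) (f : T -> \bar R) :
  uniq s -> (forall i, i \in s -> measurable (F i)) ->
  {in s &, forall i j, i != j -> m (F i `&` F j) = 0%E} ->
  measurable_fun setT f ->
  (forall i x, i \in s -> F i x -> (0 <= f x)%E) ->
  (\int[m]_(x in \big[setU/set0]_(i <- s) F i) f x =
   \sum_(i <- s) \int[m]_(x in F i) f x)%E.
Proof.
move=> + + + mf; elim: s => [|i s IHs] /=.
  by rewrite !big_nil integral_set0.
move=> /andP[iNs us] mF F0 f0; rewrite !big_cons.
have mFs j : j \in s -> measurable (F j) by move=> js; apply: mF; rewrite inE js orbT.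
have mU : measurable (\big[setU/set0]_(j <- s) F j).
  by rewrite big_seq; apply: bigsetU_measurable => j; exact: mFs.
rewrite ge0_integral_setU_null//.
- rewrite IHs// => [j k js ks|j x js].
    by apply: F0; rewrite inE ?js ?ks orbT.
  by apply: f0; rewrite inE js orbT.
- by apply: mF; rewrite mem_head.
- have mFi : measurable (F i) by apply: mF; rewrite mem_head.
  apply/negligibleP; first exact: measurableI.
  rewrite big_seq; elim/big_ind: _ => [|X Y X0 Y0|j js].
  + by rewrite setI0; exact: negligible_set0.
  + by rewrite setIUr; exact: negligibleU.
  + apply/negligibleP; first by apply: measurableI => //; exact: mFs.
    apply: F0; rewrite ?mem_head ?inE ?js ?orbT//.
    by apply: contraNneq iNs => ->.
- exact: measurable_funTS.
- move=> x [|]; first by apply: f0; rewrite mem_head.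
  rewrite -bigcup_seq => -[j js]; apply: f0.
  by rewrite inE js orbT.
Qed.
End measure_integral.

(** * Barycentric coordinates *)

Section barycentric.
Context (R : realType) (d n : nat) (x : 'I_n -> 'rV[R]_d).
Implicit Types (A B : {set 'I_n}) (c : 'cV[R]_d.+1) (p : 'rV[R]_d).

(** lam i is the coefficient vector of the affine function giving the i-th
    barycentric coordinate with respect to the simplex A. *)
Definition barycentric A (lam : 'I_n -> 'cV[R]_d.+1) :=
  [/\ {in A &, forall i j, aff (lam i) (x j) = (i == j)%:R},
      forall p, \sum_(i in A) aff (lam i) p = 1 &
      forall p, p = \sum_(i in A) aff (lam i) p *: x i].

Lemma homog_comb A (w : 'I_n -> R) p :
  homog p = \sum_(i in A) w i *: homog (x i) ->
  \sum_(i in A) w i = 1 /\ p = \sum_(i in A) w i *: x i.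
Proof.
move=> pE; split.
  have := congr1 (fun v : 'rV_d.+1 => v ord0 ord0) pE.
  rewrite mxE unlift_none summxE => ->; apply: eq_bigr => i _.
  by rewrite !mxE unlift_none mulr1.
apply/rowP => j; have := congr1 (fun v : 'rV_d.+1 => v ord0 (lift ord0 j)) pE.
rewrite mxE liftK !summxE => ->; apply: eq_bigr => i _.
by rewrite !mxE liftK.
Qed.

Lemma homog_comb_eq0 A (w : 'I_n -> R) :
  \sum_(i in A) w i *: homog (x i) = 0 ->
  \sum_(i in A) w i = 0 /\ \sum_(i in A) w i *: x i = 0.
Proof.
move=> /rowP pE; split.
  have := pE ord0; rewrite mxE summxE => w0; rewrite -[RHS]w0.
  by apply: eq_bigr => i _; rewrite !mxE unlift_none mulr1.
apply/rowP => j; have := pE (lift ord0 j).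
rewrite !mxE !summxE => w0; rewrite -[RHS]w0.
by apply: eq_bigr => i _; rewrite !mxE liftK.
Qed.

Definition homog_mx A : 'M[R]_(#|A|, d.+1) :=
  \matrix_k homog (x (enum_val k)).

Lemma aff_homog_mx A c : (homog_mx A *m c = 0) <-> {in A, forall i, aff c (x i) = 0}.
Proof.
split=> [Ac0 i iA|Ac0].
  have /rowP/(_ 0) := congr1 (row (enum_rank_in iA i)) Ac0.
  by rewrite row_mul rowK enum_rankK_in// !mxE => <-; rewrite /aff mxE.
apply/row_matrixP => k; rewrite row_mul rowK row0.
by apply/rowP => j; rewrite ord1 [RHS]mxE; apply: Ac0; exact: enum_valP.
Qed.

Lemma affinely_independent_row_free A :
  affinely_independent x A -> row_free (homog_mx A).
Proof.
move=> indA; apply/inj_row_free => v vA0.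
pose w i := \sum_(k | enum_val k == i) v ord0 k.
have wE k : w (enum_val k) = v ord0 k.
  by rewrite /w (big_pred1 k) // => l; rewrite (inj_eq enum_val_inj).
have [w0 wx0] : \sum_(i in A) w i = 0 /\ \sum_(i in A) w i *: x i = 0.
  apply: homog_comb_eq0; rewrite -[RHS]vA0 mulmx_sum_row big_enum_val/=.
  by apply: eq_bigr => k _; rewrite rowK wE.
apply/rowP => k; rewrite mxE -wE; apply: indA => //; exact: enum_valP.
Qed.

(** The matrix of the homogeneous coordinates of the vertices is square and
    row free, hence invertible; the columns of its inverse are the barycentric
    coordinates. *)
Lemma simplex_barycentric A : simplex x A -> exists lam, barycentric A lam.
Proof.
move=> [cA /affinely_independent_row_free Afree].
have Afull : row_full (homog_mx A).
  by rewrite /row_full -{2}cA; exact: Afree.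
have /row_freeP[Y XY] := Afree; have /row_fullP[Z ZX] := Afull.
have YX : Y *m homog_mx A = 1%:M.
  by rewrite -{1}[Y]mul1mx -ZX -[Z *m _ *m _]mulmxA XY mulmx1.
(* The rows of the matrix are numbered by the enumeration of A; for i in A
   the sum has one term, the column at the rank of i. *)
pose lam i := \sum_(k | enum_val k == i) col k Y.
have lamE k : lam (enum_val k) = col k Y.
  by rewrite /lam (big_pred1 k) // => l; rewrite (inj_eq enum_val_inj).
have affE p k : aff (lam (enum_val k)) p = (homog p *m Y) 0 k.
  by rewrite lamE /aff !mxE; apply: eq_bigr => l _; rewrite [col _ _ _ _]mxE.
have H p : homog p = \sum_(i in A) aff (lam i) p *: homog (x i).
  rewrite -{1}[homog p]mulmx1 -YX mulmxA mulmx_sum_row [RHS]big_enum_val/=.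
  by apply: eq_bigr => k _; rewrite rowK affE.
exists lam; split => [i j iA jA|p|p]; last 2 first.
  by have [] := homog_comb (H p).
  by have [_] := homog_comb (H p).
rewrite -(enum_rankK_in iA iA) -(enum_rankK_in jA jA) affE.
have := congr1 (fun M : 'M[R]_(#|A|, #|A|) =>
  M (enum_rank_in jA j) (enum_rank_in iA i)) XY.
rewrite !mxE (inj_eq enum_val_inj) eq_sym => <-.
by apply: eq_bigr => k _; rewrite !mxE.
Qed.

End barycentric.

Lemma conv_subset (R : realType) d n (x : 'I_n -> 'rV[R]_d) (A B : {set 'I_n}) :
  A \subset B -> conv x A `<=` conv x B.
Proof.
move=> AB _ [w [w0 w1 ->]]; exists (fun i => if i \in A then w i else 0).
split => [i||]; first by case: ifP.
  rewrite -big_mkcondr/= -w1; apply: eq_bigl => i.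
  by rewrite andb_idl// => /(fintype.subsetP AB).
rewrite [RHS](eq_bigr (fun i => if i \in A then w i *: x i else 0)); last first.
  by move=> i _; case: ifP; rewrite ?scale0r.
rewrite -big_mkcondr/=; apply: eq_bigl => i.
by rewrite andb_idl// => /(fintype.subsetP AB).
Qed.

Section barycentric_theory.
Context (R : realType) (d n : nat) (x : 'I_n -> 'rV[R]_d).
Implicit Types (A B : {set 'I_n}) (c : 'cV[R]_d.+1) (p : 'rV[R]_d).
Context A lam (lamA : barycentric x A lam).

Lemma barycentric_aff c p : aff c p = \sum_(i in A) aff (lam i) p * aff c (x i).
Proof. by case: lamA => _ l1 lp; rewrite {1}[p]lp aff_sum. Qed.

Lemma barycentric_comb (w : 'I_n -> R) B i : \sum_(j in B) w j = 1 ->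
  B \subset A -> i \in A ->
  aff (lam i) (\sum_(j in B) w j *: x j) = if i \in B then w i else 0.
Proof.
move=> w1 BA iA; rewrite aff_sum//.
have [lij _ _] := lamA.
case: ifPn => iB.
  rewrite (bigD1 i)//= lij// eqxx mulr1 big1 ?addr0// => j /andP[jB ji].
  rewrite lij//; last exact: (fintype.subsetP BA).
  by rewrite eq_sym (negbTE ji) mulr0.
rewrite big1// => j jB; rewrite lij//; last exact: (fintype.subsetP BA).
have /negbTE -> : i != j by apply: contraNneq iB => ->.
by rewrite mulr0.
Qed.

Lemma conv_barycentric p :
  conv x A p <-> forall i, i \in A -> 0 <= aff (lam i) p.
Proof.
split=> [[w [w0 w1 ->]] i iA|p0].
  by rewrite barycentric_comb// iA.
have [_ l1 lp] := lamA.
exists (fun i => if i \in A then aff (lam i) p else 0); split.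
- by move=> i; case: ifPn => // iA; exact: p0.
- by rewrite -[RHS](l1 p); apply: eq_bigr => i ->.
- by rewrite {1}[p]lp; apply: eq_bigr => i ->.
Qed.

Lemma conv_face p B i : B \subset A -> i \in A -> i \notin B ->
  conv x B p -> aff (lam i) p = 0.
Proof.
move=> BA iA iB [w [_ w1 ->]].
by rewrite barycentric_comb// (negbTE iB).
Qed.

Lemma barycentric_neq0 i : i \in A -> lam i != 0.
Proof.
move=> iA; have [/(_ i i) + _ _] := lamA; move => /(_ iA iA); rewrite eqxx => lami.
apply/eqP => lam0; move: lami; rewrite lam0 -(scale0r 0) affZ mul0r.
by move/eqP; rewrite eq_sym oner_eq0.
Qed.

End barycentric_theory.

(** * Affine functions and spheres *)

Section lifting.
Context (R : realType) (d : nat).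
Implicit Types (c : 'cV[R]_d.+1) (p z : 'rV[R]_d) (s : R).

Lemma enorm_ge0 p : 0 <= enorm p.
Proof. exact: sqrtr_ge0. Qed.

Lemma sqr_enorm p : enorm p ^+ 2 = \sum_j p ord0 j ^+ 2.
Proof. by rewrite sqr_sqrtr//; apply: sumr_ge0 => j _; exact: sqr_ge0. Qed.

(** The affine function agreeing with |p|^2 on the sphere of center z and
    squared radius s. *)
Definition sphere_aff z s : 'cV[R]_d.+1 :=
  \col_i if unlift ord0 i is Some k then z ord0 k *+ 2
         else s - enorm z ^+ 2.

Lemma aff_sphere_aff z s p :
  aff (sphere_aff z s) p = enorm p ^+ 2 - enorm (p - z) ^+ 2 + s.
Proof.
rewrite affE mxE unlift_none.
have -> : \sum_j p ord0 j * sphere_aff z s (lift ord0 j) 0 =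
    enorm p ^+ 2 - enorm (p - z) ^+ 2 + enorm z ^+ 2.
  rewrite !sqr_enorm -sumrB -big_split/=; apply: eq_bigr => j _.
  by rewrite !mxE liftK; ring.
by ring.
Qed.

(** Complete the square. *)
Lemma sphere_affP c : exists z s, c = sphere_aff z s.
Proof.
pose z := \row_j (c (lift ord0 j) 0 / 2).
exists z, (c ord0 0 + enorm z ^+ 2); apply/colP => i; rewrite mxE.
case: (unliftP ord0 i) => [j|] ->; last by rewrite addrK.
by rewrite mxE; field.
Qed.

End lifting.

Lemma subset_of_card (T : finType) (A : {set T}) k : (k <= #|A|)%N ->
  exists2 B : {set T}, B \subset A & #|B| = k.
Proof.
move=> kA; have : (0 < #|[set B : {set T} | B \subset A & #|B| == k]|)%N.
  by rewrite cards_draws bin_gt0.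
by case/card_gt0P => B; rewrite inE => /andP[BA /eqP cB]; exists B.
Qed.

Section general_position.
Context (R : realType) (d n : nat) (x : 'I_n -> 'rV[R]_d).
Implicit Types (A B : {set 'I_n}) (c : 'cV[R]_d.+1) (p : 'rV[R]_d).
Hypothesis x_gen : general_position x.

(** Otherwise the points would lie on the hyperplane where c vanishes. *)
Lemma aff_eq0 A c : (d < #|A|)%N -> {in A, forall i, aff c (x i) = 0} -> c = 0.
Proof.
move=> /subset_of_card[B BA cB] Ac0.
have Bc0 i : i \in B -> aff c (x i) = 0 by move=> /(fintype.subsetP BA); exact: Ac0.
pose a : 'rV[R]_d := \row_j c (lift ord0 j) 0.
have aff0 i : i \in B -> \sum_j a ord0 j * x i ord0 j = - c ord0 0.
  move=> /Bc0; rewrite affE => /eqP; rewrite addrC addr_eq0 => /eqP <-.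
  by apply: eq_bigr => j _; rewrite mxE mulrC.
have [/card_gt0P[i iB]] : (0 < #|B|)%N by rewrite cB.
have [a0|a0] := eqVneq a 0; last first.
  by case: (x_gen.1 B cB); exists a, (- c ord0 0); split => //; apply/eqP.
apply/colP => k; rewrite mxE; case: (unliftP ord0 k) => [j|] ->.
  by have := congr1 (fun v : 'rV_d => v ord0 j) a0; rewrite !mxE.
apply/eqP; rewrite -oppr_eq0 -(aff0 _ iB) a0.
by rewrite big1// => j _; rewrite mxE mul0r.
Qed.

(** An affine function that agrees with the heights at these points puts them
    on a common sphere. *)
Lemma card_cospherical A c :
  {in A, forall i, aff c (x i) = enorm (x i) ^+ 2} -> (#|A| <= d.+1)%N.
Proof.
move=> Ac; rewrite leqNgt; apply/negP => /subset_of_card[B BA cB].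
have [z [s cE]] := sphere_affP c.
case: (x_gen.2 B cB); exists z, (Num.sqrt s) => i /(fintype.subsetP BA) /Ac.
rewrite cE aff_sphere_aff -addrA => /eqP; rewrite -subr_eq0 addrAC subrr add0r.
rewrite addrC subr_eq0 => /eqP ->; rewrite /sphere /= sqrtr_sqr.
by rewrite ger0_norm// enorm_ge0.
Qed.

(** No nonzero affine function vanishes on A, so the square matrix of
    homogeneous coordinates has full rank, and its rows are independent. *)
Lemma simplex_of_card A : #|A| = d.+1 -> simplex x A.
Proof.
move=> cA; split => // w w0 wx0.
have Afull : row_full (homog_mx x A).
  rewrite /row_full -mxrank_tr; apply/inj_row_free => v vA.
  apply: trmx_inj; rewrite trmx0; apply: (@aff_eq0 A); first by rewrite cA.
  by apply/aff_homog_mx; apply: trmx_inj; rewrite trmx_mul trmxK trmx0.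
have Afree : row_free (homog_mx x A) by rewrite /row_free (eqP Afull) cA.
have vA0 : (\row_k w (enum_val k)) *m homog_mx x A = 0.
  rewrite mulmx_sum_row; apply/rowP => j; rewrite !mxE summxE.
  case: (unliftP ord0 j) => [l|] ->.
    have := congr1 (fun v : 'rV_d => v ord0 l) wx0; rewrite mxE summxE => w0l.
    rewrite -[RHS]w0l [RHS]big_enum_val/=; apply: eq_bigr => k _.
    by rewrite !mxE liftK.
  rewrite -[RHS]w0 [RHS]big_enum_val/=; apply: eq_bigr => k _.
  by rewrite !mxE unlift_none mulr1.
move=> i iA; have v0 := row_free_inj Afree (etrans vA0 (esym (mul0mx _ _))).
have /rowP/(_ (enum_rank_in iA i)) := v0.
by rewrite !mxE enum_rankK_in.
Qed.

(** The terms are those of linear programming: the variables are the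
    coefficients of c, with one constraint for each lifted point. *)
Definition feasible c := forall j, aff c (x j) <= enorm (x j) ^+ 2.

Definition tight c : {set 'I_n} := [set i | aff c (x i) == enorm (x i) ^+ 2].

(** Under the correspondence between affine functions and spheres, staying
    below the lifted points says that no point is inside the sphere, and being
    tight on A that the sphere passes through A. *)
Lemma delaunayP A : A \in delaunay x <->
  #|A| = d.+1 /\ exists2 c, feasible c & A \subset tight c.
Proof.
rewrite inE; split => [/asboolP[[cA _] [z [r [Ar rj]]]]|[cA [c cj Ac]]].
  split=> //.
  have r0 : 0 <= r.
    have /card_gt0P[i iA] : (0 < #|A|)%N by rewrite cA.
    by rewrite -(Ar i iA); exact: enorm_ge0.
  exists (sphere_aff z (r ^+ 2)) => [j|].
    rewrite aff_sphere_aff -addrA gerDl addrC subr_le0.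
    by rewrite ler_sqr ?nnegrE ?enorm_ge0// leNgt; apply/negP; exact: rj.
  apply/fintype.subsetP => i iA; rewrite inE aff_sphere_aff (Ar i iA).
  by rewrite addrNK.
apply/asboolP; split; first exact: simplex_of_card.
have [z [s cE]] := sphere_affP c; exists z, (Num.sqrt s).
have cjE j : enorm (x j - z) = Num.sqrt (enorm (x j) ^+ 2 - aff c (x j) + s).
  rewrite cE aff_sphere_aff opprD addrA subKr addrNK sqrtr_sqr.
  by rewrite ger0_norm// enorm_ge0.
split=> [i /(fintype.subsetP Ac)|j].
  by rewrite inE => /eqP ciE; rewrite /sphere/= cjE ciE subrr add0r.
by apply/negP; rewrite -leNgt cjE ler_wsqrtr// lerDr subr_ge0.
Qed.

End general_position.

(** * The Delaunay triangulation *)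

Section delaunay.
Context (R : realType) (d n : nat) (x : 'I_n -> 'rV[R]_d).
Implicit Types (A B : {set 'I_n}) (c m : 'cV[R]_d.+1) (p : 'rV[R]_d).
Hypotheses (x_gen : general_position x) (le_dn : (d.+1 <= n)%N).

(** The d + 1 coefficients of m are subject to at most d linear equations. A
    nonzero solution cannot vanish on all of S, and its sign can be chosen. *)
Lemma aff_vanishing A : (#|A| <= d)%N -> exists m j,
  {in A, forall i, aff m (x i) = 0} /\ 0 < aff m (x j).
Proof.
move=> cA.
have /rowV0Pn[v /sub_kermxP vA v0] : kermx (homog_mx x A)^T != 0.
  rewrite kermx_eq0 /row_free mxrank_tr neq_ltn.
  by rewrite (leq_ltn_trans (rank_leq_row _)) ?ltnS.
pose m := v^T.
have mA : {in A, forall i, aff m (x i) = 0}.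
  by apply/aff_homog_mx; rewrite -[LHS]trmxK trmx_mul trmxK vA trmx0.
have /existsP[j mj] : [exists j, aff m (x j) != 0].
  apply: contraT => /existsPn m0; move/eqP: v0; case; apply: trmx_inj; rewrite trmx0.
  apply: (aff_eq0 (A := [set: 'I_n]%SET) x_gen); first by rewrite cardsT card_ord.
  by move=> j _; have := m0 j; rewrite negbK => /eqP.
have [mj0|mj0|mj0] := ltgtP (aff m (x j)) 0; last by rewrite mj0 eqxx in mj.
  exists (- m), j; split => [i iA|]; last by rewrite affN oppr_gt0.
  by rewrite affN mA ?oppr0.
by exists m, j.
Qed.

(** Ratio test: adding multiples of m to c is limited by the points where m is
    positive, and the first of them to become tight is the one with minimal
    ratio of slack to m. *)
Lemma feasible_raise c m j0 : feasible x c -> 0 < aff m (x j0) ->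
  exists e j, [/\ 0 <= e, feasible x (c + e *: m), 0 < aff m (x j) &
                  j \in tight x (c + e *: m)].
Proof.
move=> cx mj0.
pose ratio j := (enorm (x j) ^+ 2 - aff c (x j)) / aff m (x j).
case: (arg_minP (P := fun j => 0 < aff m (x j)) ratio mj0) => j mj jmin.
have e0 : 0 <= ratio j by rewrite divr_ge0 ?subr_ge0 ?(ltW mj)//; exact: cx.
exists (ratio j), j; split => //.
  move=> k; rewrite affD affZ; have [mk|mk] := ltP 0 (aff m (x k)).
    by rewrite -lerBrDl -ler_pdivlMr//; exact: jmin.
  by rewrite (le_trans _ (cx k))// gerDl mulr_ge0_le0.
by rewrite inE affD affZ /ratio divfK ?subrKC// gt_eqF.
Qed.

(** Start from the zero function, which is feasible as heights are
    nonnegative, and add contact points one by one: raise along a direction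
    that vanishes on the current contacts. *)
Lemma feasible_tight : exists2 c, feasible x c & #|tight x c| = d.+1.
Proof.
suff [c cx ct] : exists2 c, feasible x c & (d.+1 <= #|tight x c|)%N.
  exists c => //; apply/eqP; rewrite eqn_leq ct andbT.
  apply: (card_cospherical (c := c) x_gen) => i; by rewrite inE => /eqP.
suff /(_ _ (leqnn _)) : forall k, (k <= d.+1)%N ->
  exists2 c, feasible x c & (k <= #|tight x c|)%N by [].
elim=> [_|k IHk kd].
  exists 0 => // j; rewrite -(scale0r 0) affZ mul0r; exact: sqr_ge0.
have [c cx] := IHk (ltnW kd); rewrite leq_eqVlt => /predU1P[ck|]; last by exists c.
have [|m [j0 [m0 mj0]]] := @aff_vanishing (tight x c); first by rewrite -ck.
have [e [j [e0 cx' mj jt]]] := feasible_raise cx mj0.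
exists (c + e *: m) => //; rewrite ck.
have jNt : j \notin tight x c by apply: contraTN mj => /m0 ->; rewrite ltxx.
apply: (@leq_trans #|j |: tight x c|); first by rewrite cardsU1 jNt.
apply/subset_leq_card/fintype.subsetP => i /setU1P[->//|it].
rewrite inE affD affZ m0// mulr0 addr0; by move: it; rewrite inE.
Qed.

(** The affine function whose graph carries the lower facet above a Delaunay
    simplex A. *)
Definition facet_aff A : 'cV[R]_d.+1 :=
  xget 0 [set c | feasible x c /\ A \subset tight x c].

(** General position excludes further contact points. *)
Lemma facet_aff_tight A : A \in delaunay x ->
  [/\ #|A| = d.+1, feasible x (facet_aff A) & A = tight x (facet_aff A)].
Proof.
move=> /(delaunayP x_gen)[cA [c cx Ac]].
have [fx ft] : [set c | feasible x c /\ A \subset tight x c] (facet_aff A).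
  by apply: xgetPex; exists c.
split=> //; apply/eqP; rewrite eqEcard ft cA.
by apply: (card_cospherical (c := facet_aff A) x_gen) => i; rewrite inE => /eqP.
Qed.

Lemma facet_affE A i : A \in delaunay x -> i \in A ->
  aff (facet_aff A) (x i) = enorm (x i) ^+ 2.
Proof.
by move=> /facet_aff_tight[_ _ At]; rewrite {1}At inE => /eqP.
Qed.

(** Only the vertices of A are tight. *)
Lemma facet_aff_lt A i : A \in delaunay x -> i \notin A ->
  aff (facet_aff A) (x i) < enorm (x i) ^+ 2.
Proof.
move=> /facet_aff_tight[_ fx At]; rewrite {1}At inE => fi.
by rewrite lt_neqAle fi fx.
Qed.

Lemma facet_aff_unique A c p : A \in delaunay x ->
  {in A, forall i, aff c (x i) = enorm (x i) ^+ 2} ->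
  aff (facet_aff A) p = aff c p.
Proof.
move=> AD Ac; have [cA _ _] := facet_aff_tight AD.
have [lam lamA] := simplex_barycentric (simplex_of_card x_gen cA).
rewrite !(barycentric_aff lamA); apply: eq_bigr => i iA.
by rewrite facet_affE// Ac.
Qed.

(** Let the facet function of A be maximal at p among all facets. If the
    barycentric coordinate of p at k is negative, pivot: raising the facet
    function along minus that coordinate keeps the other d vertices tight and
    gains a new contact j, which gives a facet with a larger value at p. *)
Lemma delaunay_cover p : conv x [set: 'I_n]%SET p ->
  exists2 A, A \in delaunay x & conv x A p.
Proof.
move=> px; have [c0 c0x c0t] := feasible_tight.
have D0 : tight x c0 \in delaunay x by apply/(delaunayP x_gen); split=> //; exists c0.
case: (arg_maxP (P := mem (delaunay x)) (fun A => aff (facet_aff A) p) D0).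
move=> A AD Amax; exists A => //.
have [cA fx At] := facet_aff_tight AD.
have [lam lamA] := simplex_barycentric (simplex_of_card x_gen cA).
apply/(conv_barycentric lamA) => k kA; rewrite leNgt; apply/negP => pk.
(* p is a convex combination of S, so the coordinate is negative at some
   point of S as well. *)
have [j0 mj0] : exists j, 0 < aff (- lam k) (x j).
  apply/existsP; apply: contraTT pk => /existsPn mj; rewrite -leNgt.
  case: px => w [w0 w1 ->]; rewrite aff_sum//; apply: sumr_ge0 => j _.
  by apply: mulr_ge0 => //; have := mj j; rewrite affN oppr_gt0 -leNgt.
have [e [j [e0 cx mj jt]]] := feasible_raise fx mj0.
have [lamx _ _] := lamA.
have jNA : j \notin A.
  apply: contraTN mj => jA.
  by rewrite affN lamx// oppr_gt0 -leNgt ler0n.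
have B0 : {in A :\ k, forall i, aff (- lam k) (x i) = 0}.
  by move=> i /setD1P[ik iA]; rewrite affN lamx// eq_sym (negbTE ik) oppr0.
set c := _ + _ in cx jt.
have Bt : j |: A :\ k \subset tight x c.
  apply/fintype.subsetP => i /setU1P[->//|iAk].
  rewrite inE affD affZ B0// mulr0 addr0 facet_affE//.
  by case/setD1P: iAk.
have BD : j |: A :\ k \in delaunay x.
  apply/(delaunayP x_gen); split; last by exists c.
  rewrite cardsU1 inE (negbTE jNA) andbF add1n; congr _.+1.
  by have := cardsD1 k A; rewrite kA cA add1n => -[].
have := Amax _ BD; rewrite (facet_aff_unique p BD (c := c)); last first.
  by move=> i /(fintype.subsetP Bt); rewrite inE => /eqP.
(* The step length e is not zero, because the new contact j was slack for the
   facet function of A. *)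
apply/negP; rewrite -ltNge affD affZ ltrDl mulr_gt0 ?affN ?oppr_gt0//.
rewrite lt_def e0 andbT; apply: contraTneq jt => e00.
by rewrite inE /c e00 scale0r addr0 lt_eqF// facet_aff_lt.
Qed.

(** Compare the facet of A with the interpolation of heights over B, term by
    term: the comparison is strict at every vertex of B outside of A that has
    positive weight. *)
Lemma facet_aff_le A (w : 'I_n -> R) B : A \in delaunay x ->
  (forall i, 0 <= w i) -> \sum_(i in B) w i = 1 ->
  aff (facet_aff A) (\sum_(i in B) w i *: x i) <=
    \sum_(i in B) w i * enorm (x i) ^+ 2
    ?= iff [forall i in B, (i \in A) || (w i == 0)].
Proof.
move=> AD w0 w1; rewrite aff_sum//.
have [_ fx _] := facet_aff_tight AD.
apply: leif_sum => i iB; split; first by rewrite ler_wpM2l.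
have [iA|iA] := boolP (i \in A); first by rewrite facet_affE// eqxx.
have [->|wi0] := eqVneq (w i) 0; first by rewrite !mul0r eqxx.
by rewrite (inj_eq (mulfI wi0)) lt_eqF// facet_aff_lt.
Qed.

(** For the intersection of two simplices A and B: at a common point each
    facet function is bounded by the other one, so they agree there, and the
    equality case of the comparison leaves no weight on A minus B. *)
Lemma delaunay_triangulation : triangulation x (delaunay x).
Proof.
split=> [A|p|A B AD BD].
- by move=> /facet_aff_tight[cA _ _]; exact: simplex_of_card.
- split; first exact: delaunay_cover.
  by case=> A AD; apply: conv_subset; exact: finset.subsetT.
apply/seteqP; split=> p; last first.
  move=> pAB; split; apply: conv_subset pAB.
    exact: finset.subsetIl.
  exact: finset.subsetIr.
case=> -[w [w0 w1 pw]] [v [v0 v1 pv]].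
have [wB wBE] := facet_aff_le BD w0 w1.
have [vA _] := facet_aff_le AD v0 v1.
have [_ wA] := facet_aff_le AD w0 w1.
have [_ vB] := facet_aff_le BD v0 v1.
have w_tight : aff (facet_aff A) p = \sum_(i in A) w i * enorm (x i) ^+ 2.
  by rewrite pw; apply/eqP; rewrite wA; apply/forall_inP => i ->.
have v_tight : aff (facet_aff B) p = \sum_(i in B) v i * enorm (x i) ^+ 2.
  by rewrite pv; apply/eqP; rewrite vB; apply/forall_inP => i ->.
have /forall_inP wAB : [forall i in A, (i \in B) || (w i == 0)].
  by rewrite -wBE eq_le wB -w_tight -pw v_tight pv.
have wAB0 i : i \in A :\: B -> w i = 0.
  by case/setDP => iA /negbTE iB; have := wAB i iA; rewrite iB => /eqP.
exists w; split=> //.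
  by rewrite -w1 [RHS](big_setID B)/= [X in _ = _ + X]big1 ?addr0.
rewrite pw (big_setID B)/= [X in _ + X = _]big1 ?addr0// => i /wAB0 ->.
by rewrite scale0r.
Qed.

(** The barycenter of a simplex B of the larger triangulation lies in some
    simplex A of the smaller one, hence in their common face; having only
    positive coordinates it lies in no proper face of B. *)
Lemma triangulation_subset (t t' : {set {set 'I_n}}) :
  triangulation x t -> triangulation x t' -> t \subset t' -> t = t'.
Proof.
move=> [ts tcov _] [ts' tcov' tI'] tt'; apply/eqP; rewrite finset.eqEsubset tt' /=.
apply/fintype.subsetP => B Bt'.
have [cB _] := ts' B Bt'; have [lam lamB] := simplex_barycentric (ts' B Bt').
pose w (_ : 'I_n) : R := #|B|%:R^-1.
have w0 i : 0 < w i by rewrite invr_gt0 ltr0n cB.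
have w1 : \sum_(i in B) w i = 1.
  by rewrite sumr_const /w -[LHS]mulr_natl divff// pnatr_eq0 cB.
set p := \sum_(i in B) w i *: x i.
have pB : conv x B p by exists w; split => // i; exact: ltW.
have /tcov[A At pA] : conv x [set: 'I_n]%SET p by apply/tcov'; exists B.
suff BA : B \subset A.
  have [cA _] := ts A At.
  by have /eqP -> : B == A by rewrite eqEcard BA cA cB leqnn.
apply/fintype.subsetP => k kB; apply: contraT => kA.
have : conv x (A :&: B) p by rewrite -tI'//; exact: (fintype.subsetP tt').
move/(conv_face lamB (finset.subsetIr _ _) kB) => /(_ _)/eqP.
rewrite (barycentric_comb lamB w1)// kB gt_eqF//; apply.
by rewrite inE (negbTE kA).
Qed.

End delaunay.

(** * Volume and first moments of a simplex *)

Section simplex_volume.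
Context (R : realType) (d n : nat) (x : 'I_n -> 'rV[R]_d).
Implicit Types (A B : {set 'I_n}) (c m : 'cV[R]_d.+1) (p : 'rV[R]_d).
Local Notation mu := (lebesgue_prodR R d).
Local Notation cell A := (@rV_of_prodR R d @^-1` conv x A).

Lemma cell_bounded A q j : cell A q ->
  `|rV_of_prodR q ord0 j| <= \sum_i \sum_k `|x i ord0 k|.
Proof.
case=> w [w0 w1 ->]; rewrite summxE (le_trans (ler_norm_sum _ _ _))//.
rewrite big_mkcond/=; apply: ler_sum => i _.
case: ifPn => iA; last by rewrite sumr_ge0.
rewrite mxE normrM ger0_norm// -[leRHS]mul1r ler_pM//.
  by rewrite -w1 (bigD1 i)//= lerDl sumr_ge0.
by rewrite (bigD1 j)//= lerDl sumr_ge0.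
Qed.

Section one_simplex.
Context A (sA : simplex x A) lam (lamA : barycentric x A lam).

Lemma measurable_cell : measurable (cell A).
Proof.
rewrite (_ : cell A = \bigcap_(i in [set` A]) [set q | 0 <= aff (lam i) (rV_of_prodR q)]).
  by apply: fin_bigcap_measurable => // i _; exact: measurable_aff_ge.
apply/seteqP; split => q /= => [/(conv_barycentric lamA)|Aq]; first exact.
by apply/(conv_barycentric lamA) => i iA; exact: Aq.
Qed.

Lemma cell_fin_num : mu (cell A) \is a fin_num.
Proof.
rewrite ge0_fin_numE ?measure_ge0//.
pose M := \sum_i \sum_k `|x i ord0 k|.
have M0 : 0 <= M by apply: sumr_ge0 => i _; exact: sumr_ge0.
apply: (@le_lt_trans _ _ ((M *+ 2) ^+ d)%:E); last by rewrite ltry.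
rewrite -(lebesgue_prodR_box d M0); apply: le_measure; rewrite ?inE.
- exact: measurable_cell.
- exact: measurable_box.
- by move=> q qA j; rewrite -ler_norml; exact: (cell_bounded j qA).
Qed.

(** The simplex contains a small box around its barycenter, where all the
    barycentric coordinates are equal to 1 / (d + 1). *)
Lemma cell_gt0 : (0 < mu (cell A))%E.
Proof.
have [cA _] := sA.
pose L := \sum_(i in A) \sum_j `|lam i (lift ord0 j) 0|.
have L0 : 0 <= L by apply: sumr_ge0 => i _; exact: sumr_ge0.
(* On the box of half side r a barycentric coordinate changes by at most r *
   L, which is less than 1 / (d + 1). *)
pose r : R := (d.+1%:R * (1 + L))^-1.
have L1 : 0 < 1 + L by exact: ltr_pwDl.
have r0 : 0 < r by rewrite invr_gt0 mulr_gt0// ltr0n.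
pose w (_ : 'I_n) : R := d.+1%:R^-1.
have w1 : \sum_(i in A) w i = 1.
  by rewrite sumr_const /w cA -[LHS]mulr_natl divff// pnatr_eq0.
pose b := \sum_(i in A) w i *: x i.
apply: (@lt_le_trans _ _ ((r *+ 2) ^+ d)%:E).
  by rewrite lte_fin exprn_gt0// mulrn_wgt0.
rewrite -(lebesgue_prodR_box d (ltW r0)).
rewrite -(lebesgue_prodR_shift (- b) (measurable_box d r)).
have mb := measurable_shift (- b) measurableT (measurable_box d r).
rewrite setTI in mb.
apply: le_measure; rewrite ?inE//; first exact: measurable_cell.
move=> q /= qb; apply/(conv_barycentric lamA) => i iA.
set v := rV_of_prodR q - b.
have vr j : `|v ord0 j| <= r by have := qb j; rewrite prodR_of_rVK ler_norml.
have -> : rV_of_prodR q = b + 1 *: (v - 0).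
  by rewrite scale1r subr0 addrC subrK.
rewrite aff_translate mul1r (barycentric_comb lamA w1)// iA.
rewrite !affE opprD addrACA subrr add0r.
rewrite [X in _ - X]big1 ?subr0; last by move=> j _; rewrite mxE mul0r.
rewrite -lerBlDl sub0r lerNl.
apply: (@le_trans _ _ (r * L)).
  apply: le_trans (ler_norm _) _; rewrite normrN.
  apply: le_trans (ler_norm_sum _ _ _) _.
  apply: (@le_trans _ _ (\sum_j r * `|lam i (lift ord0 j) 0|)).
    by apply: ler_sum => j _; rewrite normrM ler_wpM2r.
  rewrite -mulr_sumr ler_wpM2l ?(ltW r0)// /L (bigD1 i)//= lerDl.
  by apply: sumr_ge0 => k _; exact: sumr_ge0.
rewrite /r invfM -mulrA ger_pMr ?invr_gt0// mulrC ler_pdivrMr ?mul1r ?lerDr//.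
Qed.

(** The part of the simplex where the i-th coordinate is at least s is empty
    if s > 1, and otherwise the homothetic copy of the simplex of ratio 1 - s
    with center x i. Moving the center from x i to x j translates the copy by
    s * (x j - x i). *)
Lemma cell_superlevel i j s : i \in A -> j \in A -> 0 <= s ->
  mu (cell A `&` [set q | s <= aff (lam i) (rV_of_prodR q)]) =
  mu (cell A `&` [set q | s <= aff (lam j) (rV_of_prodR q)]).
Proof.
have [->//|ij] := eqVneq i j.
move=> iA jA s0; have [lamx _ _] := lamA.
have mS k : measurable (cell A `&` [set q | s <= aff (lam k) (rV_of_prodR q)]).
  by apply: measurableI; [exact: measurable_cell|exact: measurable_aff_ge].
rewrite -(lebesgue_prodR_shift (s *: (x i - x j)) (mS i)).
congr (mu _); apply/seteqP; split => q /=; rewrite prodR_of_rVK.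
  case=> /(conv_barycentric lamA) q0; rewrite aff_translate.
  rewrite !lamx// eqxx (negbTE ij) subr0 mulr1 lerDr => qi.
  split; last first.
    have := q0 _ jA; rewrite aff_translate !lamx// eqxx eq_sym (negbTE ij).
    by rewrite sub0r mulrN1 subr_ge0.
  apply/(conv_barycentric lamA) => k kA.
  have := q0 _ kA; rewrite aff_translate !lamx//.
  have [->//|ki] := eqVneq k i.
  by rewrite sub0r mulrN => /le_trans; apply; rewrite gerBl mulr_ge0.
case=> /(conv_barycentric lamA) q0 qj; split; last first.
  rewrite aff_translate !lamx// eqxx (negbTE ij) subr0 mulr1 lerDr; exact: q0.
apply/(conv_barycentric lamA) => k kA; rewrite aff_translate !lamx//.
have [->|kj] := eqVneq k j.
  by rewrite eq_sym (negbTE ij) sub0r mulrN1 subr_ge0.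
by rewrite subr0 addr_ge0 ?mulr_ge0//; exact: q0.
Qed.

(** The d + 1 coordinates have the same integral by the layer cake formula,
    and their sum is 1. *)
Lemma integral_barycentric i : i \in A ->
  (d.+1%:R%:E * \int[mu]_(q in cell A) (aff (lam i) (rV_of_prodR q))%:E =
   mu (cell A))%E.
Proof.
move=> iA; have [cA _] := sA; have [_ lam1 _] := lamA.
have mlam k := measurable_aff (lam k) (D := [set: prodR R d]).
have lam0 k q : k \in A -> cell A q -> 0 <= aff (lam k) (rV_of_prodR q).
  by move=> kA /(conv_barycentric lamA); exact.
transitivity (\sum_(k in A) \int[mu]_(q in cell A) (aff (lam k) (rV_of_prodR q))%:E)%E.
  rewrite (eq_bigr (fun=> \int[mu]_(q in cell A) (aff (lam i) (rV_of_prodR q))%:E)%E).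
    by rewrite sumr_const cA mule_natl.
  move=> k kA; rewrite !ge0_integral_superlevel//.
  - apply: eq_integral => s; rewrite inE/= in_itv/= andbT => s0.
    exact: cell_superlevel.
  - exact: measurable_cell.
  - by move=> q; exact: lam0.
  - exact: measurable_cell.
  - by move=> q; exact: lam0.
rewrite -ge0_integral_sum_cond.
- under eq_integral do rewrite sumEFin lam1.
  by rewrite integral_cst ?mul1e//; exact: measurable_cell.
- exact: measurable_cell.
- by move=> k _; apply/measurable_EFinP/measurable_funTS; exact: mlam.
- by move=> k q kA qA; rewrite lee_fin; exact: lam0.
Qed.

Lemma integral_simplex_comb (h : 'I_n -> R) : (forall i, 0 <= h i) ->
  (d.+1%:R%:E * \int[mu]_(q in cell A)
      (\sum_(i in A) aff (lam i) (rV_of_prodR q) * h i)%:E =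
   (\sum_(i in A) h i)%:E * mu (cell A))%E.
Proof.
move=> h0.
have lam0 k q : k \in A -> cell A q -> 0 <= aff (lam k) (rV_of_prodR q).
  by move=> kA /(conv_barycentric lamA); exact.
have mlam k : measurable_fun (cell A) (fun q => (aff (lam k) (rV_of_prodR q))%:E).
  exact/measurable_EFinP/measurable_aff.
under eq_integral do rewrite -sumEFin.
rewrite ge0_integral_sum_cond.
- under eq_bigr => i iA.
    under eq_integral do rewrite EFinM.
    rewrite ge0_integralZr//; last 3 first.
    + exact: measurable_cell.
    + by move=> q qA; rewrite lee_fin; exact: lam0.
    + by rewrite lee_fin.
    over.
  rewrite ge0_sume_distrr; last first.
    move=> i iA; apply: mule_ge0; last by rewrite lee_fin.
    by apply: integral_ge0 => q qA; rewrite lee_fin; exact: lam0.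
  rewrite -sumEFin ge0_sume_distrl; last by move=> i _; rewrite lee_fin.
  apply: eq_bigr => i iA.
  by rewrite muleA integral_barycentric// muleC.
- exact: measurable_cell.
- move=> k _; apply/measurable_EFinP; apply: measurable_funM => //.
  exact: measurable_aff.
- by move=> k q kA qA; rewrite lee_fin mulr_ge0//; exact: lam0.
Qed.

End one_simplex.

End simplex_volume.

(** * The lower hull and the parabolic functional *)

Section main.
Context (R : realType) (d n : nat) (x : 'I_n -> 'rV[R]_d).
Implicit Types (A B : {set 'I_n}) (p : 'rV[R]_d) (t : {set {set 'I_n}}).
Hypotheses (x_gen : general_position x) (le_dn : (d.+1 <= n)%N).
Local Notation mu := (lebesgue_prodR R d).
Local Notation cell A := (@rV_of_prodR R d @^-1` conv x A).

(** The facet functions are nonnegative above their own simplices, so the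
    default value 0 of the maximum is harmless on the convex hull of S. *)
Definition lower_hull p : R :=
  \big[Num.max/0]_(B in delaunay x) aff (facet_aff x B) p.

Lemma measurable_lower_hull (D : set (prodR R d)) :
  measurable_fun D (fun q => lower_hull (rV_of_prodR q)).
Proof.
rewrite /lower_hull; elim: (index_enum _) => [|B s IHs].
  by under eq_fun do rewrite big_nil; exact: measurable_cst.
under eq_fun do rewrite big_cons; case: (B \in delaunay x) => //.
by apply: measurable_maxr => //; exact: measurable_aff.
Qed.

Lemma lower_hullE B p : B \in delaunay x -> conv x B p ->
  lower_hull p = aff (facet_aff x B) p.
Proof.
move=> BD [w [w0 w1 ->]].
have pB : aff (facet_aff x B) (\sum_(i in B) w i *: x i) =
    \sum_(i in B) w i * enorm (x i) ^+ 2.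
  apply/eqP; have [_ ->] := facet_aff_le x_gen BD w0 w1.
  by apply/forall_inP => i ->.
apply/le_anti; rewrite /lower_hull.
rewrite (le_bigmax_cond _ (fun B => aff (facet_aff x B) _) BD) andbT.
apply/bigmax_leP; split=> [|A AD]; rewrite pB.
  by apply: sumr_ge0 => i _; rewrite mulr_ge0 ?sqr_ge0.
exact: facet_aff_le.
Qed.

Lemma lower_hull_ge0 p : 0 <= lower_hull p.
Proof. exact: bigmax_ge_id. Qed.

Lemma lower_hull_le A (w : 'I_n -> R) :
  (forall i, 0 <= w i) -> \sum_(i in A) w i = 1 ->
  lower_hull (\sum_(i in A) w i *: x i) <= \sum_(i in A) w i * enorm (x i) ^+ 2.
Proof.
move=> w0 w1; apply/bigmax_leP; split=> [|B BD]; last exact: facet_aff_le.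
by apply: sumr_ge0 => i _; rewrite mulr_ge0 ?sqr_ge0.
Qed.

(** Write the point in a Delaunay simplex B. The facet function of B meets the
    interpolation over A there, so B contains all vertices of A, as all of
    them have positive weight. *)
Lemma lower_hull_eq A (w : 'I_n -> R) :
  #|A| = d.+1 -> (forall i, 0 <= w i) -> (forall i, i \in A -> w i != 0) ->
  \sum_(i in A) w i = 1 ->
  \sum_(i in A) w i * enorm (x i) ^+ 2 = lower_hull (\sum_(i in A) w i *: x i) ->
  A \in delaunay x.
Proof.
move=> cA w0 wN0 w1 hE.
have pA : conv x [set: 'I_n]%SET (\sum_(i in A) w i *: x i).
  by apply: (conv_subset (finset.subsetT A)); exists w.
have [B BD pB] := delaunay_cover x_gen le_dn pA.
move: hE; rewrite (lower_hullE BD pB) => /esym/eqP.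
have [_ ->] := facet_aff_le x_gen BD w0 w1; move=> /forall_inP wB.
have AB : A \subset B.
  apply/fintype.subsetP => i iA; have := wB i iA.
  by rewrite (negbTE (wN0 i iA)) orbF.
have [cB _ _] := facet_aff_tight x_gen BD.
by have /eqP -> : A == B by rewrite eqEcard AB cA cB leqnn.
Qed.

(** Two distinct simplices of a triangulation meet in a proper face, which
    lies in a hyperplane and is therefore negligible. *)
Lemma integral_lower_hull t : triangulation x t ->
  (\int[mu]_(q in cell [set: 'I_n]%SET) (lower_hull (rV_of_prodR q))%:E =
   \sum_(A in t) \int[mu]_(q in cell A) (lower_hull (rV_of_prodR q))%:E)%E.
Proof.
move=> [ts tcov tI]; rewrite -big_enum/=.
have mcell A : A \in enum t -> measurable (cell A).
  rewrite mem_enum => /ts sA; have [lam lamA] := simplex_barycentric sA.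
  exact: (measurable_cell lamA).
rewrite -ge0_integral_bigsetU_null//.
- congr (integral _ _ _); rewrite -bigcup_seq; apply/seteqP; split => q /=.
    by move=> /tcov[A At Aq]; exists A => //=; rewrite mem_enum.
  by case=> A /=; rewrite mem_enum => At Aq; apply/tcov; exists A.
- exact: enum_uniq.
- move=> A B; rewrite !mem_enum => At Bt AB.
  have [lam lamA] := simplex_barycentric (ts A At).
  have [i iA iB] : exists2 i, i \in A & i \notin B.
    apply/exists_inP; apply: contraNT AB => /exists_inPn AB.
    rewrite eqEcard (proj1 (ts A At)) (proj1 (ts B Bt)) leqnn andbT.
    by apply/fintype.subsetP => i /AB; rewrite negbK.
  apply: subset_measure0 (measurable_hyperplane (lam i)) _
    (lebesgue_prodR_hyperplane (barycentric_neq0 lamA iA)).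
    by apply: measurableI; apply: mcell; rewrite mem_enum.
  move=> q [Aq Bq] /=; have : (conv x A `&` conv x B) (rV_of_prodR q) by [].
  rewrite tI//; apply: (conv_face lamA (finset.subsetIl _ _) iA).
  by rewrite inE negb_and iB orbT.
- by apply/measurable_EFinP; exact: measurable_lower_hull.
- by move=> A q _ _; rewrite lee_fin lower_hull_ge0.
Qed.

Lemma lower_hull_fin_num A : simplex x A ->
  (\int[mu]_(q in cell A) (lower_hull (rV_of_prodR q))%:E)%E \is a fin_num.
Proof.
move=> sA; have [lam lamA] := simplex_barycentric sA.
have mA := measurable_cell lamA; have fA := cell_fin_num lamA.
rewrite ge0_fin_numE; last first.
  by apply: integral_ge0 => q _; rewrite lee_fin lower_hull_ge0.
apply: (@le_lt_trans _ _ (\int[mu]_(q in cell A) (\sum_i enorm (x i) ^+ 2)%:E)%E).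
  apply: ge0_le_integral => //.
  - by move=> q _; rewrite lee_fin lower_hull_ge0.
  - by apply/measurable_EFinP; exact: measurable_lower_hull.
  - move=> q [w [w0 w1 qw]]; rewrite lee_fin qw.
    apply: le_trans (lower_hull_le w0 w1) _.
    rewrite big_mkcond/=; apply: ler_sum => i _.
    case: ifPn => iA; last exact: sqr_ge0.
    rewrite ler_piMl ?sqr_ge0// -w1 (bigD1 i)//= lerDl.
    exact: sumr_ge0.
rewrite integral_cst// lte_mul_pinfty//.
  by rewrite lee_fin sumr_ge0// => i _; exact: sqr_ge0.
by rewrite -ge0_fin_numE.
Qed.

Lemma volE A : (vol (conv x A) = fine (mu (cell A))).
Proof. by rewrite /vol image_prodR_of_rV prodR_lebesgueE. Qed.

Definition simplex_excess A : R :=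
  (\sum_(i in A) enorm (x i) ^+ 2) * vol (conv x A) -
  d.+1%:R * fine (\int[mu]_(q in cell A) (lower_hull (rV_of_prodR q))%:E)%E.

(** The contribution of A to Vr is d + 1 times the integral of the
    interpolation f of the heights over A, and f is at least the lower hull.
    If the integrals agree then f meets the lower hull almost everywhere on A,
    in particular at some point with no zero barycentric coordinate, since A
    has positive volume; this forces A to be Delaunay. *)
Lemma simplex_excess_ge0 A : simplex x A ->
  0 <= simplex_excess A ?= iff (A \in delaunay x).
Proof.
move=> sA; have [lam lamA] := simplex_barycentric sA.
pose f (q : prodR R d) := \sum_(i in A) aff (lam i) (rV_of_prodR q) * enorm (x i) ^+ 2.
pose I := (\int[mu]_(q in cell A) (f q)%:E)%E.
pose G := (\int[mu]_(q in cell A) (lower_hull (rV_of_prodR q))%:E)%E.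
have mA := measurable_cell lamA; have fA := cell_fin_num lamA.
have [cA _] := sA; have [_ lam1 lamp] := lamA.
have weights q : cell A q -> exists w : 'I_n -> R,
    [/\ forall i, 0 <= w i, \sum_(i in A) w i = 1,
        rV_of_prodR q = \sum_(i in A) w i *: x i,
        f q = \sum_(i in A) w i * enorm (x i) ^+ 2 &
        {in A, forall i, w i = aff (lam i) (rV_of_prodR q)}].
  move=> /(conv_barycentric lamA) q0.
  exists (fun i => if i \in A then aff (lam i) (rV_of_prodR q) else 0); split.
  - by move=> i; case: ifPn => //; exact: q0.
  - by rewrite -[RHS](lam1 (rV_of_prodR q)); apply: eq_bigr => i ->.
  - by rewrite {1}[rV_of_prodR q]lamp; apply: eq_bigr => i ->.
  - by apply: eq_bigr => i ->.
  - by move=> i ->.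
have c0 : (d.+1%:R : R) != 0 by rewrite pnatr_eq0.
have IE : (d.+1%:R%:E * I = ((\sum_(i in A) enorm (x i) ^+ 2) * vol (conv x A))%:E)%E.
  rewrite (integral_simplex_comb sA lamA) => [|i]; last exact: sqr_ge0.
  by rewrite EFinM volE fineK.
have Ifin : I \is a fin_num.
  by rewrite -[I]mul1e -(mulVf c0) EFinM -muleA IE -EFinM.
have f_ge q : cell A q -> 0 <= lower_hull (rV_of_prodR q) <= f q.
  move=> /weights[w [w0 w1 -> -> _]].
  by rewrite lower_hull_ge0 lower_hull_le.
have mf : measurable_fun setT f.
  rewrite /f; under eq_fun do rewrite big_mkcond/=.
  apply: measurable_sum => i; case: (i \in A) => //.
  by apply: measurable_funM => //; exact: measurable_aff.
have GI : (G <= I)%E.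
  apply: ge0_le_integral => //.
  - by move=> q _; rewrite lee_fin lower_hull_ge0.
  - by apply/measurable_EFinP; exact: measurable_lower_hull.
  - by apply/measurable_EFinP; exact: measurable_funTS.
  - by move=> q /f_ge /andP[_]; rewrite lee_fin.
have Gfin : G \is a fin_num by exact: lower_hull_fin_num.
have -> : simplex_excess A = d.+1%:R * (fine I - fine G).
  rewrite /simplex_excess -/G mulrBr; congr (_ - _).
  by apply: EFin_inj; rewrite -IE EFinM fineK.
split; first by rewrite mulr_ge0// subr_ge0 fine_le.
rewrite eq_sym mulf_eq0 (negbTE c0)/= subr_eq0.
apply/eqP/idP => [IG|AD]; last first.
  congr fine; apply: eq_integral => q; rewrite inE => Aq; congr EFin.
  rewrite (lower_hullE AD Aq); have [w [w0 w1 -> -> _]] := weights _ Aq.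
  apply/esym/eqP; have [_ ->] := facet_aff_le x_gen AD w0 w1.
  by apply/forall_inP => i ->.
apply: contraT => AND.
have fE : \forall q \ae mu, cell A q -> f q = lower_hull (rV_of_prodR q).
  apply: ge0_integral_eq_ae => //.
  - exact: measurable_lower_hull.
  - by rewrite -/I ltey_eq Ifin.
  - by rewrite -/I -/G -(fineK Ifin) IG fineK.
have lamN0 : \forall q \ae mu, forall i, i \in A -> aff (lam i) (rV_of_prodR q) != 0.
  apply: filter_forall => i.
  have [iA|iA] := boolP (i \in A); last exact: filterE.
  apply: negligibleS (_ : mu.-negligible [set q | aff (lam i) (rV_of_prodR q) = 0]).
    by move=> q /= /not_implyP[_ /negP]; rewrite negbK => /eqP.
  apply/negligibleP; first exact: measurable_hyperplane.
  exact: lebesgue_prodR_hyperplane (barycentric_neq0 lamA iA).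
have : mu.-negligible (cell A).
  have : \forall q \ae mu, ~ cell A q.
    apply: filterS2 fE lamN0 => q fq lq Aq.
    have [w [w0 w1 qw fw wl]] := weights _ Aq.
    move/negP: AND; apply; apply: (lower_hull_eq cA w0 _ w1).
      by move=> i iA; rewrite wl// lq.
    by rewrite -fw -qw fq.
  by apply: negligibleS => q Aq /=; apply.
move/(negligibleP _ mA) => mA0; have := cell_gt0 sA lamA.
by rewrite mA0 ltxx.
Qed.

(** All triangulations share the constant U, the integral of d + 1 times the
    lower hull over the convex hull of S, so they differ in their excesses
    only, and these vanish exactly on Delaunay simplices. *)
Theorem Vr_min t : triangulation x t ->
  Vr x (delaunay x) <= Vr x t ?= iff (t == delaunay x).
Proof.
move=> tt; pose U := d.+1%:R * fine (\int[mu]_(q in cell [set: 'I_n]%SET)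
  (lower_hull (rV_of_prodR q))%:E)%E.
have VrE s : triangulation x s -> Vr x s = \sum_(A in s) simplex_excess A + U.
  move=> st; have [ss _ _] := st.
  rewrite /U (integral_lower_hull st) -sum_fine; last first.
    by move=> A /ss; exact: lower_hull_fin_num.
  rewrite mulr_sumr -big_split/=; apply: eq_bigr => A _.
  by rewrite /simplex_excess subrK.
have [ts _ _] := tt; have DT := delaunay_triangulation x_gen le_dn.
rewrite (VrE _ tt) (VrE _ DT) big1 => [|A AD]; last first.
  have [DS _ _] := DT; have [_ ] := simplex_excess_ge0 (DS A AD).
  by rewrite AD => /eqP.
have := leif_sum (fun A (At : A \in t) => simplex_excess_ge0 (ts A At)).
rewrite big1// => -[le0 eq0]; split; first by rewrite lerD2r.
rewrite (inj_eq (addIr _)) eq0; apply/forall_inP/eqP => [tD|-> //].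
by apply: triangulation_subset tt DT _; apply/fintype.subsetP => A; exact: tD.
Qed.
End main.

Theorem theorem1 (R : realType) (d n : nat) (x : 'I_n -> 'rV[R]_d)
    (x_inj : injective x) (le_dn : (d.+1 <= n)%N)
    (x_gen : general_position x) (t : {set {set 'I_n}}) :
  (triangulation x t /\
   (forall t' : {set {set 'I_n}}, triangulation x t' -> (Vr x t <= Vr x t')%R))
  <-> t = delaunay x.
Proof.
have DT := delaunay_triangulation x_gen le_dn.
split=> [[tt tmin]|->]; last by split=> // t' /(Vr_min x_gen le_dn)[].
apply/eqP; have [le_t <-] := Vr_min x_gen le_dn tt.
by rewrite eq_le le_t tmin.
Qed.
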